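(* Let $\theta>0$ and let $R_m$ denote the $m$-th upper record value from the Lomax distribution with parameter $\theta$. For $x\ge 0$ and $m\ge1$ define $$\hat f_{(\mathrm{Records};m)}(x)=\frac{m}{\ln(1+R_m)}(1+x)^{-\left(\frac{m}{\ln(1+R_m)}+1\right)},\qquad \hat F_{(\mathrm{Records};m)}(x)=1-(1+x)^{-\frac{m}{\ln(1+R_m)}}.$$ Then these estimators are asymptotically unbiased for the density and the distribution function of the Lomax distribution, i.e. for every $x\ge 0$: (I) $\displaystyle\lim_{m\to+\infty}E[\hat f_{(\mathrm{Records};m)}(x)]=\frac1\theta(1+x)^{-(\frac1\theta+1)}$; (II) $\displaystyle\lim_{m\to+\infty}E[\hat F_{(\mathrm{Records};m)}(x)]=1-(1+x)^{-\frac1\theta}$.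
   Context: The Lomax distribution with parameter $\theta>0$ has probability density function $f(x;\theta)=\frac1\theta(1+x)^{-(\frac1\theta+1)}$ for $x\ge 0$ (and $0$ for $x<0$) and cumulative distribution function $F(x;\theta)=1-(1+x)^{-1/\theta}$ for $x\ge0$. Upper record values: for an infinite i.i.d. sequence $X_1,X_2,\dots$ from a continuous distribution, set $T_1=1$, $T_{k+1}=\min\{j>T_k: X_j>X_{T_k}\}$ (almost surely finite for the Lomax distribution), and $R_k=X_{T_k}$; $R_k$ is the $k$-th upper record value. The joint density of $(R_1,\dots,R_m)$ is $f(r_m;\theta)\prod_{i=1}^{m-1}\frac{f(r_i;\theta)}{1-F(r_i;\theta)}$ on $0\le r_1<\dots<r_m$. $\hat f_{(\mathrm{Records};m)}$ and $\hat F_{(\mathrm{Records};m)}$ are the plug-in maximum likelihood estimators based on the first $m$ upper records, obtained by substituting $\hat\theta=\ln(1+R_m)/m$ for $\theta$; they are defined almost surely since $R_m>0$ almost surely. *)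

(* Defs.v *)
From HB Require Import structures.
From mathcomp Require Import all_boot all_order all_algebra.
From mathcomp Require Import finmap.
From mathcomp Require Import all_classical all_reals all_analysis.

Set Implicit Arguments.
Unset Strict Implicit.
Unset Printing Implicit Defensive.

Import Order.TTheory GRing.Theory Num.Theory.
Import numFieldNormedType.Exports.

Local Open Scope classical_set_scope.
Local Open Scope ring_scope.

Definition lomax_pdf (R : realType) (theta : R) : R -> R :=
  (fun x => theta^-1 * (1 + x) `^ (- (theta^-1 + 1))) \_ `[0, +oo[.

Definition lomax_prob (R : realType) (theta : R) (A : set R) : \bar R :=
  (\int[lebesgue_measure]_(x in A) (lomax_pdf theta x)%:E)%E.

(* The two sides are compared on Borel sets only: off the Borel sigma-algebra
   neither function is meaningful. *)
Definition lomax_distributed d (T : measurableType d) (R : realType)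
    (P : probability T R) (theta : R) (X : {RV P >-> R}) : Prop :=
  forall A : set R, measurable A -> distribution P X A = lomax_prob theta A.

Definition mutually_independent d (T : measurableType d) (R : realType)
    (P : probability T R) (I : choiceType) (X : I -> {RV P >-> R}) : Prop :=
  forall (J : {fset I}) (A : I -> set R),
    (forall i, measurable (A i)) ->
    P (\bigcap_(i in [set` J]) (X i @^-1` A i)) =
    (\prod_(i <- J) P (X i @^-1` A i))%E.

(* Least j > n with x j > x n. If no such j exists (a null event for i.i.d.
   observations from a continuous distribution), the junk value is n. *)
Definition next_record (R : realType) (x : R^nat) (n : nat) : nat :=
  if pselect (exists j, (n < j)%N && (x n < x j)) is left jP
  then ex_minn jP else n.

(* Observations and record times are numbered from 0: x 0 is the first
   observation, and record_time x k is the 0-based index of the record of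
   rank k + 1. *)
Fixpoint record_time (R : realType) (x : R^nat) (k : nat) : nat :=
  if k is k'.+1 then next_record x (record_time x k') else 0%N.

(* The m-th upper record value, for m >= 1 (m = 0 is a junk case). *)
Definition upper_record (R : realType) (x : R^nat) (m : nat) : R :=
  x (record_time x m.-1).

(* Plug-in estimators at the maximum likelihood estimate ln (1 + r) / m of the
   parameter, r being the value of the m-th upper record. *)
Definition records_pdf_estimator (R : realType) (m : nat) (r x : R) : R :=
  m%:R / ln (1 + r) * (1 + x) `^ (- (m%:R / ln (1 + r) + 1)).

Definition records_cdf_estimator (R : realType) (m : nat) (r x : R) : R :=
  1 - (1 + x) `^ (- (m%:R / ln (1 + r))).

(* Main.v *)
Require Import Defs.
From HB Require Import structures.
From mathcomp Require Import all_boot all_order all_algebra.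
From mathcomp Require Import finmap.
From mathcomp Require Import all_classical all_reals all_analysis.
From mathcomp Require Import measurable_realfun lra ring zify.

(** Let S(x) = (1 + x)^(-1/theta) be the Lomax survival function and
    V_m = S(R_m).  Both estimators are functions of the maximum likelihood
    estimate, through u = m / ln (1 + R_m) = m / (theta * - ln V_m), and
    everything follows from the Laplace transform of - ln V_m,

      E[V_m^a] = (1 + a)^(-m)   for a >= 0   (integral_upper_record),

    which says that - ln V_m has the Gamma(m, 1) law.

    This formula is proved one record at a time, without computing any law of
    record times.  For a Lomax variable Y,
    E[1_{Y > r} S(Y)^a] = S(r)^(a + 1) / (1 + a) = E[1_{Y > r} S(r)^a] / (1 + a)
    (integral_lomax_sf_tail).  The event that one record occurs at time j and
    the following one at time n is an event of the past before n intersected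
    with {X_j < X_n}.  As X_n is independent of that past
    (mutually_independent_past), on this event the integral of S(X_n)^a is that
    of S(X_j)^a divided by 1 + a (integral_past_record).  These events, over
    all j < n, cover a set of probability 1, because no bound dominates a whole
    tail of the sequence (probability_unbounded_records); summing over j and n
    gives E[V_{m+1}^a] = E[V_m^a] / (1 + a) (integral_upper_recordS).

    Now let Z_m = V_m^(1/m).  Taking a = 1/m and a = 2/m shows that the first
    two moments of Z_m tend to e^(-1) and e^(-2), so that Z_m converges to
    e^(-1) in mean square.  An estimator g(u) is a function of Z_m which is
    continuous at e^(-1), where u = 1/theta; if g is bounded, its expectation
    therefore converges to g(1/theta) (cvg_integral_plug_in).  This covers the
    distribution function, and the density at every x > 0.

    At x = 0 the density estimator is u itself, which is unbounded.  There
    1 / (- ln V_m) is the integral of V_m^a over a >= 0, and Tonelli's theorem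
    gives E[u] = m / (theta * (m - 1)) exactly (integral_inv_mle). *)

Set Implicit Arguments.
Unset Strict Implicit.
Unset Printing Implicit Defensive.

Import Order.TTheory GRing.Theory Num.Theory.
Import numFieldNormedType.Exports.
Import HBNNSimple.

Local Open Scope classical_set_scope.
Local Open Scope ring_scope.

(** * Integrals against a density, and tails of power functions *)

(** Both sides are additive and monotone continuous in f, so that the case of
    indicator functions, which is the hypothesis, is enough. *)
Lemma ge0_expectation_density d1 d2 (T : measurableType d1)
    (U : measurableType d2) (R : realType) (P : probability T R)
    (X : {RV P >-> U}) (mu : {measure set U -> \bar R}) (g : U -> R) :
    measurable_fun [set: U] g -> (forall x, 0 <= g x) ->
    (forall A, measurable A -> P (X @^-1` A) = \int[mu]_(x in A) (g x)%:E)%E ->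
  forall f : U -> R, measurable_fun [set: U] f -> (forall x, 0 <= f x) ->
  (\int[P]_w (f (X w))%:E = \int[mu]_x (f x * g x)%:E)%E.
Proof.
move=> mg g0 nuE f mf f0.
have mEg : measurable_fun [set: U] (EFin \o g : U -> \bar R).
  exact/measurable_EFinP.
have mEf : measurable_fun [set: U] (EFin \o f : U -> \bar R).
  exact/measurable_EFinP.
pose nu : {measure set U -> \bar R} := distribution P X.
transitivity (\int[nu]_x (f x)%:E)%E.
  by rewrite ge0_integral_distribution//; move=> y; rewrite lee_fin.
have {}nuE A : measurable A -> (nu A = \int[mu]_(x in A) (g x)%:E)%E := nuE A.
move: nu nuE => {P X T} nu nuE.
have indic A : measurable A ->
    (\int[nu]_x (\1_A x)%:E = \int[mu]_x ((\1_A x)%:E * (g x)%:E))%E.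
  move=> mA; rewrite integral_indic// setIT nuE// integral_mkcond.
  apply: eq_integral => x _; rewrite patchE indicE.
  by case: ifPn => _; rewrite ?mul1e ?mul0e.
pose h := nnsfun_approx measurableT mEf.
have simple n : (\int[nu]_x (h n x)%:E = \int[mu]_x ((h n x)%:E * (g x)%:E))%E.
  under eq_integral do rewrite fimfunE -fsumEFin//.
  rewrite ge0_integral_fsum//; last 2 first.
  - by move=> r; exact/measurable_EFinP/measurableT_comp.
  - by move=> r x _; rewrite EFinM nnfun_muleindic_ge0.
  under [RHS]eq_integral.
    move=> x xD; rewrite fimfunE -fsumEFin// muleC ge0_mule_fsumr; last first.
      by move=> r; rewrite EFinM nnfun_muleindic_ge0.
    over.
  rewrite [RHS]ge0_integral_fsum//; last 2 first.
  - move=> r; apply: emeasurable_funM => //.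
    exact/measurable_EFinP/measurableT_comp.
  - move=> r x _; apply: mule_ge0; first by rewrite lee_fin.
    by rewrite EFinM nnfun_muleindic_ge0.
  apply: eq_fsbigr => r /set_mem[x _ <-].
  have mr : measurable (h n @^-1` [set h n x]) by [].
  under eq_integral do rewrite EFinM.
  rewrite ge0_integralZl//; last 2 first.
  - exact/measurable_EFinP/measurable_indic.
  - by rewrite lee_fin.
  rewrite indic// -ge0_integralZl//; last 3 first.
  - by apply: emeasurable_funM => //; exact/measurable_EFinP/measurable_indic.
  - by move=> y _; rewrite mule_ge0// lee_fin.
  - by rewrite lee_fin.
  by apply: eq_integral => y _; rewrite EFinM muleA [LHS]muleC.
have hf x : (fun n => (h n x)%:E) @ \oo --> (f x)%:E.
  by apply: (cvg_nnsfun_approx measurableT mEf) => // y _; rewrite /= lee_fin.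
have nd x : nondecreasing_seq (fun n => (h n x)%:E).
  by move=> a b ab; rewrite lee_fin; exact/lefP/nd_nnsfun_approx.
have <- : limn (fun n => \int[nu]_x (h n x)%:E)%E = (\int[nu]_x (f x)%:E)%E.
  rewrite -monotone_convergence//.
  - by apply: eq_integral => x _; apply/cvg_lim => //; exact: hf.
  - by move=> n; exact/measurable_EFinP.
  - by move=> n x _; rewrite lee_fin.
have <- : limn (fun n => \int[mu]_x ((h n x)%:E * (g x)%:E))%E =
    (\int[mu]_x (f x * g x)%:E)%E.
  rewrite -monotone_convergence//.
  - apply: eq_integral => x _; apply/cvg_lim => //; rewrite EFinM.
    by apply: cvgeMr => //; exact: hf.
  - by move=> n; apply: emeasurable_funM => //; exact/measurable_EFinP.
  - by move=> n x _; rewrite mule_ge0// lee_fin.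
  - by move=> x _ a b ab; apply: lee_wpmul2r; [rewrite lee_fin|exact: nd].
by congr (limn _); apply/funext => n; exact: simple.
Qed.

Lemma cvgy_powRN {R : realType} (b : R) : 0 < b ->
  (1 + x) `^ (- b) @[x --> +oo] --> (0 : R).
Proof.
move=> b0; apply/cvgrPdist_le => e e0; near=> x.
have x0 : e `^ (- b^-1) <= x by near: x; exact: nbhs_pinfty_ge.
have x1 : 0 < 1 + x by rewrite ltr_wpDr// (le_trans (powR_ge0 _ _) x0).
rewrite sub0r normrN ger0_norm ?powR_ge0// powRN -[leRHS]invrK.
rewrite lef_pV2 ?posrE ?powR_gt0 ?invr_gt0//.
rewrite -[leLHS](_ : (e `^ (- b^-1)) `^ b = _).
  by rewrite ge0_ler_powR ?nnegrE ?powR_ge0 ?ltW//; lra.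
by rewrite -powRrM mulNr mulVf ?gt_eqF// powR_inv1// ltW.
Unshelve. all: by end_near. Qed.

Lemma is_derive_powR1D {R : realType} (p x : R) : 0 < 1 + x ->
  is_derive x 1 (fun x : R => (1 + x) `^ p) (p * (1 + x) `^ (p - 1)).
Proof.
move=> x1; have d1 : is_derive x 1 (fun x : R => 1 + x) 1.
  by apply: is_derive_eq; rewrite add0r mulr1.
by have := is_derive1_comp (is_derive1_powR p x1) d1; rewrite mulr1.
Qed.

Lemma continuous_powR1D {R : realType} (p x : R) : 0 < 1 + x ->
  {for x, continuous (fun x : R => (1 + x) `^ p)}.
Proof.
move=> x1; apply: differentiable_continuous; apply/derivable1_diffP.
by have [] := is_derive_powR1D p x1.
Qed.

(** Total on [u, +oo[, from the antiderivative - (1 + x)^(- b) / b, which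
    vanishes at infinity. *)
Lemma integral_powR_tail {R : realType} (b u : R) : 0 < b -> 0 <= u ->
  (\int[lebesgue_measure]_(x in `[u, +oo[) ((1 + x) `^ (- (b + 1)))%:E
   = (b^-1 * (1 + u) `^ (- b))%:E)%E.
Proof.
move=> b0 u0.
pose F (x : R) := - b^-1 * (1 + x) `^ (- b).
have dF (x : R) : 0 < 1 + x -> is_derive x 1 F ((1 + x) `^ (- (b + 1))).
  move=> x1; have dp := is_derive_powR1D (- b) x1.
  apply: is_derive_eq.
  by rewrite /GRing.scale/= mulrA mulrNN mulVf ?gt_eqF// mul1r opprD.
have cvgR (f : R -> R) : {for u, continuous f} -> f x @[x --> u^'+] --> f u.
  exact: cvg_at_right_filter.
rewrite (@ge0_continuous_FTC2y _ _ F u 0).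
- by rewrite sub0e -EFinN /F mulNr opprK.
- by move=> x _; exact: powR_ge0.
- apply/continuous_within_itvcyP; split.
    move=> x; rewrite in_itv/= andbT => ux.
    by apply: continuous_powR1D; lra.
  by apply: cvgR; apply: continuous_powR1D; lra.
- rewrite -[X in _ --> X](mulr0 (- b^-1)).
  by apply: cvgMr; exact: cvgy_powRN.
- by move=> x ux; have [] := dF x ltac:(lra).
- by apply: cvgR; apply: cvgMr; apply: continuous_powR1D; lra.
- move=> x; rewrite in_itv/= andbT => ux; rewrite derive1E.
  by have [] := dF x ltac:(lra).
Qed.

(** * The survival function of the Lomax distribution *)

(** The maximum makes this the survival function P(X > x) at every real x, not
    only on the support: the identities below then need no sign condition. *)
Definition lomax_sf {R : realType} (theta x : R) : R :=
  (1 + Num.max 0 x) `^ (- theta^-1).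

Lemma lomax_sf0 {R : realType} (theta : R) : lomax_sf theta 0 = 1.
Proof. by rewrite /lomax_sf maxxx addr0 powR1. Qed.

Section lomax_sf.
Context {R : realType} (theta : R).
Hypothesis theta_gt0 : 0 < theta.

Lemma lomax_sf_gt0 (x : R) : 0 < lomax_sf theta x.
Proof. by rewrite powR_gt0// ltr_pwDl// le_max lexx. Qed.

Lemma lomax_sf_le1 (x : R) : lomax_sf theta x <= 1.
Proof.
rewrite -(powRr0 (1 + Num.max 0 x)) ler_powR//.
  by rewrite lerDl le_max lexx.
by rewrite oppr_le0 invr_ge0 ltW.
Qed.

Lemma lomax_sf_max (x : R) : lomax_sf theta x = lomax_sf theta (Num.max 0 x).
Proof. by rewrite /lomax_sf maxA maxxx. Qed.

Lemma lomax_sf_powR (a x : R) : 0 <= x ->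
  lomax_sf theta x `^ a = (1 + x) `^ (- (theta^-1 * a)).
Proof. by move=> x0; rewrite /lomax_sf max_r// -powRrM mulNr. Qed.

Lemma measurable_lomax_sf : measurable_fun [set: R] (lomax_sf theta).
Proof.
apply: (measurableT_comp (measurable_powR _)).
by apply: measurable_funD => //; exact: measurable_maxr.
Qed.

Lemma lomax_pdf_ge0 (x : R) : 0 <= lomax_pdf theta x.
Proof.
apply: restrict_ge0 => {}x _.
by rewrite mulr_ge0 ?powR_ge0// invr_ge0 ltW.
Qed.

Lemma measurable_lomax_pdf : measurable_fun [set: R] (lomax_pdf theta).
Proof.
apply/measurable_restrict => //; apply: measurable_funTS.
apply: measurable_funM => //.
by apply: (measurableT_comp (measurable_powR _)); exact: measurable_funD.
Qed.

(** For x >= 0 the product of S(x)^a and the density is a multiple of a Lomax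
    density, of survival function S^(1 + a).  This self-similarity is what makes
    a record step multiply the moments of S by the constant 1 / (1 + a). *)
Lemma integral_lomax_sf_tail d (T : measurableType d) (P : probability T R)
    (X : {RV P >-> R}) (a u : R) :
    lomax_distributed theta X -> 0 <= a ->
  (\int[P]_w (\1_`]u, +oo[ (X w) * lomax_sf theta (X w) `^ a)%:E =
   ((1 + a)^-1 * lomax_sf theta u `^ (1 + a))%:E)%E.
Proof.
move=> XL a0; pose b := theta^-1 * (1 + a).
have b0 : 0 < b by rewrite mulr_gt0 ?invr_gt0// ltr_wpDr.
pose G (x : R) := theta^-1 * (1 + x) `^ (- (b + 1)).
have mG : measurable_fun [set: R] (EFin \o G : R -> \bar R).
  apply/measurable_EFinP; apply: measurable_funM => //.
  by apply: (measurableT_comp (measurable_powR _)); exact: measurable_funD.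
(* Lebesgue measure lives on measurableTypeR R, whose display differs from that
   of R although the measurable sets are the same: X is viewed as valued there. *)
have mX : measurable_fun setT (X : T -> measurableTypeR R).
  exact: (@measurable_funPT _ _ _ _ X).
pose X' : {RV P >-> measurableTypeR R} :=
  HB.pack (X : T -> measurableTypeR R) (isMeasurableFun.Build _ _ _ _ _ mX).
pose f y := \1_`]u, +oo[ y * lomax_sf theta y `^ a.
rewrite [LHS](@ge0_expectation_density _ _ _ _ _ P X' lebesgue_measure
    (lomax_pdf theta) measurable_lomax_pdf lomax_pdf_ge0 XL f); last 2 first.
- apply: measurable_funM; first exact: measurable_indic.
  by apply: (measurableT_comp (measurable_powR _)); exact: measurable_lomax_sf.
- by move=> x; rewrite mulr_ge0// powR_ge0.
transitivity
  (\int[lebesgue_measure]_(x in `]u, +oo[ `&` `[0%R, +oo[) (G x)%:E)%E.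
  rewrite [RHS]integral_mkcond; apply: eq_integral => x _.
  rewrite patchE; case: ifPn => [/set_mem[xu x0]|/negP xn].
    have {}x0 : 0 <= x by move: x0; rewrite /= in_itv/= andbT.
    rewrite /f indicE mem_set// mul1r lomax_sf_powR//.
    rewrite /lomax_pdf patchE mem_set/=; last by rewrite in_itv/= andbT.
    rewrite mulrCA -powRD; last by apply/implyP => _; rewrite gt_eqF// ltr_pwDl.
    by congr (_ * _ `^ _)%:E; rewrite /b; ring.
  rewrite /f indicE /lomax_pdf patchE.
  case: ifPn => [/set_mem x0|]; last by rewrite mulr0.
  case: (boolP (x \in _)) => [/set_mem xu|]; last by rewrite !mul0r.
  by exfalso; apply: xn; apply/mem_set.
have Gtail v : 0 <= v ->
    (\int[lebesgue_measure]_(x in `[v, +oo[) (G x)%:E =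
     ((1 + a)^-1 * lomax_sf theta v `^ (1 + a))%:E)%E.
  move=> v0; under eq_integral do rewrite EFinM.
  rewrite ge0_integralZl//; last 3 first.
  - apply/measurable_EFinP/measurable_funTS.
    by apply: (measurableT_comp (measurable_powR _)); exact: measurable_funD.
  - by move=> x _; rewrite lee_fin powR_ge0.
  - by rewrite lee_fin invr_ge0 ltW.
  rewrite integral_powR_tail// lomax_sf_powR// -EFinM mulrA.
  have theta0 : theta != 0 by rewrite gt_eqF.
  have a10 : 1 + a != 0 by rewrite gt_eqF// ltr_pwDl.
  by congr (_ * _)%:E; rewrite /b; field; rewrite a10.
rewrite lomax_sf_max; case: (leP 0 u) => u0.
  rewrite (_ : _ `&` _ = `]u, +oo[%classic); last first.
    apply/seteqP; split => [x [//]|x /=]; rewrite !in_itv/= !andbT => ux.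
    by split => //; lra.
  by rewrite integral_itv_obnd_cbnd ?Gtail//; exact: measurable_funTS.
rewrite (_ : _ `&` _ = `[0, +oo[%classic) ?Gtail//.
apply/seteqP; split => [x []//|x /=]; rewrite !in_itv/= !andbT => ux.
by split => //; lra.
Qed.

Lemma lomax_gt u d (T : measurableType d) (P : probability T R)
    (X : {RV P >-> R}) :
    lomax_distributed theta X -> P [set w | u < X w] = (lomax_sf theta u)%:E.
Proof.
move=> XL; have := integral_lomax_sf_tail u XL (lexx 0).
rewrite addr0 invr1 mul1r powRr1 ?ltW ?lomax_sf_gt0// => <-.
under eq_integral do rewrite powRr0 mulr1.
have mX : measurable (X @^-1` `]u, +oo[) by exact: measurable_funPTI.
transitivity (\int[P]_w (\1_(X @^-1` `]u, +oo[) w)%:E)%E => //.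
rewrite integral_indic// setIT.
by congr (P _); apply/seteqP; split => w /=; rewrite in_itv/= andbT.
Qed.

End lomax_sf.

(** * Independence of an observation from the past *)

(** A pi-system, on which mutual independence can be applied directly, and which
    generates the sigma-algebra of the first n observations. *)
Definition past_rectangles {T : Type} {R : realType} (X : nat -> T -> R)
    (n : nat) : set (set T) :=
  [set B | exists2 A : nat -> set R, (forall i, measurable (A i)) &
    B = \bigcap_(i in `I_n) (X i @^-1` A i)].

Section past.
Context {R : realType} d (T : measurableType d) (P : probability T R).
Variable X : nat -> {RV P >-> R}.

Definition past (n : nat) : set (set T) :=
  <<s past_rectangles (fun i => X i : T -> R) n >>.

Lemma past_rectangles_measurable n :
  past_rectangles (fun i => X i : T -> R) n `<=` measurable.
Proof.
move=> _ [A mA ->]; apply: bigcap_measurableType => i _.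
exact: measurable_funPTI.
Qed.

Lemma past_measurable n : past n `<=` measurable.
Proof.
apply: smallest_sub; first exact: sigma_algebra_measurable.
exact: past_rectangles_measurable.
Qed.

Lemma measurable_fun_past n k : (k < n)%N ->
  measurable_fun [set: g_sigma_algebraType
      (past_rectangles (fun i => X i : T -> R) n)] (X k : T -> R).
Proof.
move=> kn _ A mA; rewrite setTI; apply: sub_sigma_algebra.
exists (fun i => if i == k then A else setT) => [l|]; first by case: ifPn.
apply/seteqP; split => w /=.
  by move=> Aw l /= ln; case: ifPn => [/eqP ->|].
by move=> /(_ k kn); rewrite eqxx.
Qed.

Lemma past_lt n i j : (i < n)%N -> (j < n)%N -> past n [set w | X i w < X j w].
Proof.
move=> ni nj.
have := measurable_fun_ltr (measurable_fun_past ni) (measurable_fun_past nj).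
move=> /(_ measurableT [set true]); rewrite setTI; exact.
Qed.

Lemma pastS m n : (m <= n)%N -> past m `<=` past n.
Proof.
move=> mn; apply: sub_sigma_algebra2 => _ [A mA ->].
exists (fun i => if (i < m)%N then A i else setT) => [l|]; first by case: ifPn.
apply/seteqP; split => w /= H l /= ln.
  by case: ifPn => //; exact: H.
by have := H l (leq_trans ln mn); rewrite ln.
Qed.

Hypothesis X_indep : mutually_independent X.

(** The two sides are finite measures of B which agree on the pi-system of
    rectangles, hence on the sigma-algebra it generates. *)
Lemma mutually_independent_past n (B : set T) (C : set R) :
    past n B -> measurable C ->
  P (B `&` X n @^-1` C) = (P B * P (X n @^-1` C))%E.
Proof.
move=> pB mC; have mE : measurable (X n @^-1` C) by exact: measurable_funPTI.
have r0 : 0 <= fine (P (X n @^-1` C)) by rewrite fine_ge0.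
pose m2 : {measure set T -> \bar R} := mscale (NngNum r0) P.
pose m1 : {measure set T -> \bar R} := mrestr P mE.
suff : m1 B = m2 B.
  rewrite /m1 /m2 /= /mrestr /mscale/= => ->.
  by rewrite fineK ?fin_num_measure// muleC.
apply: (@g_sigma_algebra_measure_unique _ _ _
  (past_rectangles (fun i => X i : T -> R) n) _ (fun=> setT)) => //.
- exact: past_rectangles_measurable.
- move=> _; exists (fun=> setT) => //.
  by apply/seteqP; split => w // _ i _.
- by rewrite bigcup_const//; exists 0%N.
- move=> _ _ [A1 mA1 ->] [A2 mA2 ->]; exists (fun i => A1 i `&` A2 i).
    by move=> i; exact: measurableI.
  by rewrite -bigcapI.
- move=> _ [A mA ->]; rewrite /m1 /m2 /= /mrestr /mscale/=.
  pose A' i := if i == n then C else A i.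
  have mA' i : measurable (A' i) by rewrite /A'; case: ifPn.
  pose J := [fset i in iota 0 n]%fset.
  have Jn : n \notin J by rewrite !inE/= mem_iota/= ltnn.
  have JA : \bigcap_(i in `I_n) (X i @^-1` A i) =
      \bigcap_(i in [set` J]) (X i @^-1` A' i).
    apply/seteqP; split => w H i /=.
      rewrite !inE/= mem_iota/= add0n => iltn; rewrite /A' ltn_eqF//.
      exact: H.
    move=> iltn; have := H i; rewrite /= !inE/= mem_iota/= add0n => /(_ iltn).
    by rewrite /A' ltn_eqF.
  have := @X_indep (n |` J)%fset A' mA'.
  rewrite big_fsetU1//= -X_indep// -JA bigcap_fsetU1 -JA.
  rewrite {1 2}/A' eqxx setIC => ->.
  by rewrite fineK ?fin_num_measure.
- move=> _; rewrite /m1/= /mrestr setTI.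
  by rewrite (le_lt_trans (probability_le1 _ mE))// ltry.
Qed.

End past.

(** * One record step *)

(** The joint law of Z and X is the product of their laws, so that the integral
    can be computed by Tonelli's theorem. *)
Lemma integral_independent {R : realType} d (T : measurableType d)
    (P : probability T R) d1 (U : measurableType d1) d2 (V : measurableType d2)
    (Z : {RV P >-> U}) (X : {RV P >-> V}) (f : U * V -> \bar R) :
    (forall B C, measurable B -> measurable C ->
      P (Z @^-1` B `&` X @^-1` C) = P (Z @^-1` B) * P (X @^-1` C))%E ->
    measurable_fun [set: U * V] f -> (forall z, (0 <= f z)%E) ->
  (\int[P]_w f (Z w, X w) = \int[P]_w \int[P]_w' f (Z w, X w'))%E.
Proof.
move=> indep mf f0.
have mZX : measurable_fun [set: T] (fun w => (Z w, X w)).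
  exact: measurable_fun_pair.
pose ZX : {RV P >-> (U * V)%type} :=
  HB.pack (fun w => (Z w, X w)) (isMeasurableFun.Build _ _ _ _ _ mZX).
pose PZ := distribution P Z; pose PX := distribution P X.
transitivity (\int[distribution P ZX]_z f z)%E.
  by rewrite ge0_integral_distribution.
transitivity (\int[PZ \x PX]_z f z)%E.
  apply: eq_measure_integral => A mA _; symmetry.
  by apply: product_measure_unique => // B C mB mC; exact: indep.
rewrite fubini_tonelli1// ge0_integral_distribution//; last 2 first.
- exact: measurable_fun_fubini_tonelli_F.
- by move=> z; exact: integral_ge0.
apply: eq_integral => w _; rewrite /= /fubini_F.
rewrite ge0_integral_distribution//; exact: measurableT_comp.
Qed.

Section record_step.
Context {R : realType} d (T : measurableType d) (P : probability T R).
Variables (theta : R) (X : nat -> {RV P >-> R}).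
Hypothesis theta_gt0 : 0 < theta.
Hypothesis X_indep : mutually_independent X.
Hypothesis X_lomax : forall n, lomax_distributed theta (X n).

Let sf := lomax_sf theta.

(** Given the past, in which A and X j are determined, both integrals reduce by
    the tail identity for X n to the integral of 1_A S(X j)^(1 + a): with the
    factor 1 / (1 + a) for S(X n)^a, and without it for S(X j)^a, whose integral
    only involves P(X n > X j) = S(X j). *)
Lemma integral_past_record (n j : nat) (A : set T) (a : R) :
    past X n A -> (j < n)%N -> 0 <= a ->
  (\int[P]_(w in A `&` [set w | (X j w < X n w)%R]) (sf (X n w) `^ a)%:E =
   (1 + a)^-1%:E *
   \int[P]_(w in A `&` [set w | (X j w < X n w)%R]) (sf (X j w) `^ a)%:E)%E.
Proof.
move=> pA jn a0; have mA := past_measurable pA.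
pose G := past_rectangles (fun i => X i : T -> R) n.
have mZG : measurable_fun [set: g_sigma_algebraType G]
    ((fun w => (X j w, \1_A w)) : g_sigma_algebraType G -> R * R).
  apply: measurable_fun_pair; first exact: measurable_fun_past.
  exact: measurable_indic.
have mZ : measurable_fun [set: T] (fun w => (X j w, \1_A w) : R * R).
  by apply: measurable_fun_pair => //; exact: measurable_indic.
pose Z : {RV P >-> (R * R)%type} :=
  HB.pack (fun w => (X j w, \1_A w) : R * R)
    (isMeasurableFun.Build _ _ _ _ _ mZ).
have indep B C : measurable B -> measurable C ->
    (P (Z @^-1` B `&` X n @^-1` C) = P (Z @^-1` B) * P (X n @^-1` C))%E.
  move=> mB mC; apply: mutually_independent_past => //.
  by have := mZG measurableT B mB; rewrite setTI; exact.
(* The indicator of A enters as a second coordinate of Z, so that Z carries all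
   the information on the past; the absolute value only serves to make L
   nonnegative outside of the range of Z. *)
pose L (z : R * R * R) : R := `|z.1.2| * \1_[set z : R * R * R | z.1.1 < z.2] z.
have mL : measurable_fun [set: R * R * R] L.
  apply: measurable_funM.
    apply: (measurableT_comp (@normr_measurable _ setT)).
    by apply: (measurableT_comp measurable_snd); exact: measurable_fst.
  apply: measurable_indic.
  have m1 : measurable_fun [set: R * R * R] (fun z : R * R * R => z.1.1).
    by apply: (measurableT_comp measurable_fst); exact: measurable_fst.
  have m2 : measurable_fun [set: R * R * R] (fun z : R * R * R => z.2).
    exact: measurable_snd.
  have := measurable_fun_ltr m1 m2.
  by move=> /(_ measurableT [set true]); rewrite setTI; exact.
have LE w w' : L (Z w, X n w') = \1_A w * \1_`]X j w, +oo[ (X n w').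
  rewrite /L /= ger0_norm//; congr (_ * _); rewrite !indicE; congr (_%:R).
  congr nat_of_bool.
  by apply/idP/idP => /set_mem H; apply/mem_set; move: H;
    rewrite /= in_itv/= andbT.
have L0 z : 0 <= L z by rewrite mulr_ge0.
clearbody L.
have msfr r : measurable_fun [set: R] (fun x => sf x `^ r).
  by apply: (measurableT_comp (measurable_powR _)); exact: measurable_lomax_sf.
have msfa := msfr a.
have toL g : (\int[P]_(w in A `&` [set w | (X j w < X n w)%R]) (g w)%:E =
    \int[P]_w (L (Z w, X n w) * g w)%:E)%E.
  rewrite integral_mkcond; apply: eq_integral => w _.
  rewrite patchE; case: ifPn => [/set_mem[/= wA ltX]|wA].
    by rewrite LE !indicE !mem_set ?mul1r//= in_itv/= ltX.
  rewrite LE !indicE; case: (boolP (w \in A)) => [/set_mem Aw|]; last first.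
    by rewrite !mul0r.
  rewrite memNset ?mulr0 ?mul0r// => /=; rewrite in_itv/= andbT => ltX.
  by move/negP: wA; apply; apply/mem_set.
have mX2 : measurable_fun [set: R * R * R] (fun z : R * R * R => sf z.2 `^ a).
  by apply: (measurableT_comp msfa); exact: measurable_snd.
have mX1 : measurable_fun [set: R * R * R] (fun z : R * R * R => sf z.1.1 `^ a).
  apply: (measurableT_comp msfa).
  by apply: (measurableT_comp measurable_fst); exact: measurable_fst.
have mEX n' : measurable_fun [set: T] (fun w => sf (X n' w) `^ a).
  exact: (measurableT_comp msfa).
have m1A : measurable_fun [set: T] (\1_A : T -> R) by exact: measurable_indic.
have sfa0 y : 0 <= sf y `^ a by exact: powR_ge0.
have m1X u : measurable_fun [set: T] (fun w => \1_`]u, +oo[ (X n w) : R).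
  by apply: measurableT_comp => //; exact: measurable_indic.
have mtail : measurable_fun [set: T] (fun w => \1_A w * sf (X j w) `^ (1 + a)).
  by apply: measurable_funM => //; exact: (measurableT_comp (msfr _)).
have innerX c u : 0 <= c ->
    (\int[P]_w (c%:E * (\1_`]u, +oo[ (X n w) * sf (X n w) `^ a)%:E) =
     c%:E * ((1 + a)^-1 * sf u `^ (1 + a))%:E)%E.
  move=> c0; rewrite ge0_integralZl//; last 2 first.
  - by apply/measurable_EFinP; exact: measurable_funM.
  - by move=> w' _; rewrite lee_fin mulr_ge0.
  by rewrite integral_lomax_sf_tail.
have innerT c u : 0 <= c ->
    (\int[P]_w (c%:E * (\1_`]u, +oo[ (X n w))%:E) = (c * sf u)%:E)%E.
  move=> c0; rewrite ge0_integralZl//; last first.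
    exact/measurable_EFinP.
  rewrite EFinM; congr (_ * _)%E.
  have := integral_lomax_sf_tail theta_gt0 u (X_lomax n) (lexx 0).
  rewrite addr0 invr1 mul1r powRr1 ?ltW ?lomax_sf_gt0// => <-.
  by apply: eq_integral => w' _; rewrite powRr0 mulr1.
have XnE : (\int[P]_w (L (Z w, X n w) * sf (X n w) `^ a)%:E =
    \int[P]_w \int[P]_w' (L (Z w, X n w') * sf (X n w') `^ a)%:E)%E.
  apply: (@integral_independent _ _ _ P _ _ _ _ Z (X n)
    (fun z => (L z * sf z.2 `^ a)%:E) indep).
    by apply/measurable_EFinP; apply: measurable_funM; [exact: mL|exact: mX2].
  by move=> z; rewrite lee_fin mulr_ge0.
have XjE : (\int[P]_w (L (Z w, X n w) * sf (X j w) `^ a)%:E =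
    \int[P]_w \int[P]_w' (L (Z w, X n w') * sf (X j w) `^ a)%:E)%E.
  apply: (@integral_independent _ _ _ P _ _ _ _ Z (X n)
    (fun z => (L z * sf z.1.1 `^ a)%:E) indep).
    by apply/measurable_EFinP; apply: measurable_funM; [exact: mL|exact: mX1].
  by move=> z; rewrite lee_fin mulr_ge0.
pose tail := (\int[P]_w (\1_A w * sf (X j w) `^ (1 + a))%:E)%E.
have tailE : (\int[P]_w ((1 + a)^-1%:E * (\1_A w * sf (X j w) `^ (1 + a))%:E) =
    (1 + a)^-1%:E * tail)%E.
  apply: ge0_integralZl => //.
  - exact/measurable_EFinP.
  - by move=> w _; rewrite lee_fin mulr_ge0// powR_ge0.
  - by rewrite lee_fin invr_ge0 addr_ge0.
transitivity ((1 + a)^-1%:E * tail)%E.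
  apply: etrans (toL (fun w => sf (X n w) `^ a)) _.
  apply: etrans XnE _.
  rewrite -tailE; apply: eq_integral => w _.
  under eq_integral do rewrite LE -mulrA EFinM.
  by rewrite innerX// EFinM muleCA.
congr (_ * _)%E; apply: esym.
apply: etrans (toL (fun w => sf (X j w) `^ a)) _.
apply: etrans XjE _.
apply: eq_integral => w _.
under eq_integral do rewrite LE mulrAC EFinM.
rewrite innerT ?mulr_ge0// -mulrA addrC powRD; last first.
  by apply/implyP => _; rewrite gt_eqF// lomax_sf_gt0.
by rewrite powRr1// ltW// lomax_sf_gt0.
Qed.

End record_step.

(** * Record times *)
Lemma next_recordP {R : realType} (x : R^nat) (j n : nat) : (j < n)%N ->
  next_record x j = n <->
    (forall i, (j < i < n)%N -> x i <= x j) /\ x j < x n.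
Proof.
move=> jn; rewrite /next_record; case: pselect => [ex|nex]; last first.
  split=> [/eqP|[_ xjn]]; first by rewrite ltn_eqF.
  by exfalso; apply: nex; exists n; rewrite jn.
case: ex_minnP => m /andP[jm xjm] minm; split=> [mn|[run xjn]].
  rewrite -mn; split=> // i /andP[ji im]; rewrite leNgt; apply/negP => xji.
  by have := minm i; rewrite ji xji leqNgt im => /(_ isT).
apply/eqP; rewrite eqn_leq minm ?jn// leqNgt; apply/negP => mn.
by have := run m; rewrite jm mn leNgt xjm => /(_ isT).
Qed.

Lemma next_record_ge {R : realType} (x : R^nat) (j : nat) :
  (j <= next_record x j)%N.
Proof.
rewrite /next_record; case: pselect => // ex.
by case: ex_minnP => m /andP[/ltnW].
Qed.

Lemma next_record_stall {R : realType} (x : R^nat) (j : nat) :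
  next_record x j = j <-> forall i, (j < i)%N -> x i <= x j.
Proof.
rewrite /next_record; case: pselect => [ex|nex]; last first.
  split=> // _ i ji; rewrite leNgt; apply/negP => xji; apply: nex.
  by exists i; rewrite ji.
case: ex_minnP => m /andP[jm xjm] _; split=> [mj|/(_ m jm)].
  by move: jm; rewrite mj ltnn.
by rewrite leNgt xjm.
Qed.

Section records.
Context {R : realType} d (T : measurableType d) (P : probability T R).
Variables (theta : R) (X : nat -> {RV P >-> R}).

Definition overtake (j n : nat) : set T := [set w | X j w < X n w].

Definition dominant (j n : nat) : set T :=
  [set w | forall i, (j < i < n)%N -> X i w <= X j w].

(** The event that the (k+1)-st record occurs at time n.  Unlike the equation
    record_time _ k = n, which by the junk value of next_record also holds when
    the records stop at n and hence depends on the whole future, it only depends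
    on the first n + 1 observations. *)
Fixpoint record_at (k n : nat) : set T :=
  if k is k'.+1
  then \bigcup_(j in `I_n) (record_at k' j `&` dominant j n `&` overtake j n)
  else if n is 0%N then setT else set0.

(** The event that the records never stop; there record_at and record_time
    agree. *)
Definition unbounded_records : set T :=
  [set w | forall j, exists2 n, (j < n)%N & X j w < X n w].

Lemma past_dominant j n : (j < n)%N -> past X n (dominant j n).
Proof.
move=> jn; pose G := past_rectangles (fun i => X i : T -> R) n.
have -> : dominant j n = \bigcap_(i in [set i | (j < i < n)%N]) ~` overtake j i.
  by apply/seteqP; split => w /= H i /H /=; rewrite leNgt => /negP.
apply: (@bigcap_measurableType _ (g_sigma_algebraType G)) => i /andP[_ ltin].
by apply: measurableC; exact: past_lt.
Qed.

Lemma past_record_at k n : past X n.+1 (record_at k n).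
Proof.
elim: k n => [|k IH] [|n] /=; try
  exact: (@measurableT _ (g_sigma_algebraType _)).
- exact: sigma_algebra0.
- by rewrite II0 bigcup0//; exact: sigma_algebra0.
- pose G := past_rectangles (fun i => X i : T -> R) n.+2.
  apply: (@bigcup_measurable _ (g_sigma_algebraType G)) => j /= jn.
  apply: (@measurableI _ (g_sigma_algebraType G)); last by apply: past_lt; lia.
  apply: (@measurableI _ (g_sigma_algebraType G)); first by apply: pastS (IH j); lia.
  by apply: pastS (past_dominant jn); lia.
Qed.

Lemma record_at_record_time k n w :
  record_at k n w -> record_time (X ^~ w) k = n.
Proof.
elim: k n => [|k IH] [|n] //=.
- by rewrite II0 bigcup0.
- move=> [j jn [[/IH -> dom] ov]].
  by apply/next_recordP.
Qed.

Lemma unbounded_record_at k w : unbounded_records w ->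
  record_at k (record_time (X ^~ w) k) w.
Proof.
move=> unb; elim: k => //= k IH.
set j := record_time _ k in IH *.
have jn : (j < next_record (X ^~ w) j)%N.
  rewrite ltn_neqAle next_record_ge andbT; apply/eqP => /esym.
  move=> /next_record_stall stall; have [n jn] := unb j.
  by rewrite ltNge stall.
have /(next_recordP _ jn)[dom ov] := erefl (next_record (X ^~ w) j).
by exists j.
Qed.

Lemma measurable_next_record j n :
  measurable [set w | next_record (X ^~ w) j = n].
Proof.
have mdom i : (j < i)%N -> measurable (dominant j i).
  by move=> ji; exact: past_measurable (past_dominant ji).
have [nj|jn|->] := ltngtP n j.
- rewrite (_ : mkset _ = set0)//; apply/seteqP; split => w //= E.
  by have := next_record_ge (X ^~ w) j; rewrite E leqNgt nj.
- rewrite (_ : mkset _ = dominant j n `&` overtake j n).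
    apply: measurableI; first exact: mdom.
    by apply: (@past_measurable _ _ _ _ X n.+1); apply: past_lt; lia.
  by apply/seteqP; split => w /=; rewrite next_recordP.
- rewrite (_ : mkset _ = \bigcap_(i in [set i | (j < i)%N]) dominant j i).
    by apply: bigcap_measurableType => i /=; exact: mdom.
  apply/seteqP; split => w /=.
    by move=> /next_record_stall H i _ l /andP[+ _]; exact: H.
  move=> H; apply/next_record_stall => i ji.
  by apply: (H i.+1) => /=; lia.
Qed.

Lemma measurable_record_time k n :
  measurable [set w | record_time (X ^~ w) k = n].
Proof.
elim: k n => [|k IH] n /=.
  have [<-|n0] := eqVneq 0%N n.
    by rewrite (_ : mkset _ = setT)//; apply/seteqP; split.
  rewrite (_ : mkset _ = set0)//; apply/seteqP; split => // w /eqP.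
  by rewrite (negbTE n0).
rewrite (_ : mkset _ = \bigcup_j ([set w | record_time (X ^~ w) k = j] `&`
    [set w | next_record (X ^~ w) j = n])).
  by apply: bigcupT_measurable => j; apply: measurableI => //;
     exact: measurable_next_record.
apply/seteqP; split => w /=; first by move=> <-; exists (record_time (X ^~ w) k).
by move=> [j _ [/= -> ->]].
Qed.

Lemma measurable_upper_record m :
  measurable_fun [set: T] (fun w => upper_record (X ^~ w) m).
Proof.
move=> _ A mA; rewrite setTI.
rewrite (_ : _ @^-1` _ = \bigcup_n ([set w | record_time (X ^~ w) m.-1 = n] `&`
    X n @^-1` A)).
  apply: bigcupT_measurable => n; apply: measurableI.
    exact: measurable_record_time.
  exact: measurable_funPTI.
apply/seteqP; split => w /=.
  by move=> Aw; exists (record_time (X ^~ w) m.-1).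
by move=> [n _ [/= <-]].
Qed.

Lemma measurable_unbounded_records : measurable unbounded_records.
Proof.
rewrite (_ : unbounded_records =
    \bigcap_j \bigcup_(n in [set n | (j < n)%N]) overtake j n).
  apply: bigcapT_measurable => j; apply: bigcup_measurable => n /= jn.
  by apply: (@past_measurable _ _ _ _ X n.+1); apply: past_lt; lia.
apply/seteqP; split => w H j; last by have [n jn ov] := H j I; exists n.
by move=> _; have [n jn ov] := H j; exists n.
Qed.


Hypothesis theta_gt0 : 0 < theta.
Hypothesis X_indep : mutually_independent X.
Hypothesis X_lomax : forall n, lomax_distributed theta (X n).

Lemma probability_bounded_tail (j N : nat) (q : R) :
  (P (\bigcap_(i in `I_(j.+1 + N))
        X i @^-1` (if (j < i)%N then `]-oo, q]%classic else setT))
   <= ((1 - lomax_sf theta q) ^+ N)%:E)%E.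
Proof.
pose A i : set R := if (j < i)%N then `]-oo, q]%classic else setT.
have mA i : measurable (A i) by rewrite /A; case: ifPn.
elim: N => [|N IH].
  apply: probability_le1; apply: bigcap_measurableType => i _.
  by apply: measurable_funPTI; exact: (mA i).
rewrite addnS IIS bigcap_setU bigcap_set1.
rewrite (mutually_independent_past X_indep)//; last 2 first.
- by apply: sub_sigma_algebra; exists A.
- exact: (mA (j.+1 + N)%N).
rewrite exprS mulrC EFinM; apply: lee_pmul => //.
rewrite (_ : (j < j.+1 + N)%N); last by lia.
rewrite (_ : _ @^-1` _ = ~` [set w | q < X (j.+1 + N) w]); last first.
  by apply/seteqP; split => w /=; rewrite in_itv/= leNgt => /negP.
rewrite probability_setC ?(lomax_gt theta_gt0)//.
rewrite (_ : mkset _ = X (j.+1 + N) @^-1` `]q, +oo[).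
  exact: measurable_funPTI.
by apply/seteqP; split => w /=; rewrite in_itv/= andbT.
Qed.

(** If the records stop at j, all later observations are below some integer q.
    By independence this has probability at most (1 - S(q))^N for all N. *)
Lemma probability_unbounded_records : P (~` unbounded_records) = 0%E.
Proof.
pose A q j i : set R := if (j < i)%N then `]-oo, q%:R]%classic else setT.
pose B j q : set T := \bigcap_i X i @^-1` A q j i.
have mA q j i : measurable (A q j i) by rewrite /A; case: ifPn.
have mB j q : measurable (B j q).
  by apply: bigcapT_measurable => i; exact: measurable_funPTI.
have B0 j q : P (B j q) = 0%E.
  apply/eqP; rewrite eq_le measure_ge0 andbT.
  pose r := 1 - lomax_sf theta q%:R.
  have r1 : `|r| < 1.
    have := lomax_sf_gt0 theta (q%:R : R).
    have := lomax_sf_le1 theta_gt0 (q%:R : R).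
    by rewrite /r => ? ?; rewrite ger0_norm; lra.
  have rN : (fun N => (r ^+ N)%:E) @ \oo --> 0%E.
    by apply: cvg_EFin; [exact: nearW|exact: cvg_expr].
  apply: cvge_ge rN; apply: nearW => N.
  apply: le_trans (probability_bounded_tail j N q%:R).
  apply: le_measure; rewrite ?inE; [exact: mB| |].
    apply: bigcap_measurableType => i _; apply: measurable_funPTI.
    exact: (mA q j i).
  by move=> w Bw i _; exact: Bw.
apply: (@subset_measure0 _ _ _ _ _ (\bigcup_j \bigcup_q B j q)).
- exact: measurableC measurable_unbounded_records.
- by apply: bigcupT_measurable => j; exact: bigcupT_measurable.
- move=> w /= /existsNP[j Hj]; exists j => //.
  exists (Num.bound `|X j w|) => // i _; rewrite /A/=; case: ifPn => // ji.
  rewrite /= in_itv/=.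
  have : X i w <= X j w by rewrite leNgt; apply/negP => h; apply: Hj; exists i.
  move=> /le_trans; apply; apply: (le_trans (ler_norm _)).
  by rewrite ltW// archi_boundP.
- apply/negligibleP.
    by apply: bigcupT_measurable => j; exact: bigcupT_measurable.
  apply: negligible_bigcup => j; apply: negligible_bigcup => q.
  by apply/negligibleP; [exact: mB|exact: B0].
Qed.

End records.

(** * Moments of the survival function at a record *)
Lemma eq_integral_fibers {R : realType} d (T : measurableType d)
    (mu : {measure set T -> \bar R}) (D : set T) (tau : T -> nat)
    (f g : T -> \bar R) :
    measurable D -> (forall n, measurable [set w | tau w = n]) ->
    measurable_fun [set: T] f -> measurable_fun [set: T] g ->
    (forall w, 0 <= f w)%E -> (forall w, 0 <= g w)%E ->
    (forall n, \int[mu]_(w in D `&` [set w | tau w = n]) f w =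
               \int[mu]_(w in D `&` [set w | tau w = n]) g w)%E ->
  (\int[mu]_(w in D) f w = \int[mu]_(w in D) g w)%E.
Proof.
move=> mD mtau mf mg f0 g0 fg.
have DE : D = \bigcup_n (D `&` [set w | tau w = n]).
  by apply/seteqP; split => w; [move=> Dw; exists (tau w)|move=> [n _ []]].
have mDn n : measurable (D `&` [set w | tau w = n]) by exact: measurableI.
have tDn : trivIset setT (fun n => D `&` [set w | tau w = n]).
  apply/trivIsetP => m n _ _ /eqP mn.
  by apply/seteqP; split => // w [[_ /= ->] [_ /=]].
rewrite DE !ge0_integral_bigcup//; last 2 first.
- exact: measurable_funTS.
- exact: measurable_funTS.
by apply: eq_eseriesr => n _; exact: fg.
Qed.

Section record_moments.
Context {R : realType} d (T : measurableType d) (P : probability T R).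
Variables (theta : R) (X : nat -> {RV P >-> R}).
Hypothesis theta_gt0 : 0 < theta.
Hypothesis X_indep : mutually_independent X.
Hypothesis X_lomax : forall n, lomax_distributed theta (X n).

Let record m w := upper_record (X ^~ w) m.
Let time k w := record_time (X ^~ w) k.

(** The integrals are compared on each event that two consecutive records occur
    at times j and n. *)
Lemma integral_upper_recordS (k : nat) (a : R) : 0 <= a ->
  (\int[P]_w (lomax_sf theta (record k.+2 w) `^ a)%:E =
   \int[P]_w ((1 + a)^-1 * lomax_sf theta (record k.+1 w) `^ a)%:E)%E.
Proof.
move=> a0.
pose f m w := (lomax_sf theta (record m w) `^ a)%:E.
pose g w := ((1 + a)^-1%:E * f k.+1 w)%E.
have mf m : measurable_fun [set: T] (f m).
  apply/measurable_EFinP; apply: (measurableT_comp (measurable_powR _)).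
  apply: (measurableT_comp (measurable_lomax_sf theta)).
  exact: measurable_upper_record.
have f0 m w : (0 <= f m w)%E by rewrite lee_fin powR_ge0.
have mg : measurable_fun [set: T] g by exact: measurable_funeM.
have g0 w : (0 <= g w)%E by rewrite mule_ge0// lee_fin invr_ge0 addr_ge0.
have mU := measurable_unbounded_records X.
have U0 := probability_unbounded_records theta_gt0 X_indep X_lomax.
have IU h C : measurable C -> measurable_fun [set: T] h ->
    (forall w, 0 <= h w)%E ->
    (\int[P]_(w in C) h w = \int[P]_(w in unbounded_records X `&` C) h w)%E.
  move=> mC mh h0.
  rewrite (@ge0_negligible_integral _ _ _ _ _ (~` unbounded_records X))//.
  - by rewrite setDE setCK setIC.
  - exact: measurableC.
  - exact: measurable_funTS.
rewrite (IU (f k.+2))// setIT; symmetry.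
transitivity (\int[P]_w g w)%E => //.
rewrite (IU g)// setIT; symmetry.
(* On unbounded_records, times n <= j are impossible, and for j < n the fiber is
   an event C to which the one-step identity applies. *)
apply: (@eq_integral_fibers _ _ _ _ _ (time k)) => //.
  exact: measurable_record_time.
move=> j; apply: (@eq_integral_fibers _ _ _ _ _ (time k.+1)) => //.
- by apply: measurableI => //; exact: measurable_record_time.
- exact: measurable_record_time.
move=> n; have [jn|nj] := ltnP j n; last first.
  rewrite (_ : _ `&` _ = set0) ?integral_set0//.
  apply/seteqP; split => // w [[Uw /= kj] kn].
  have : record_at X k.+1 (time k.+1 w) w by exact: unbounded_record_at.
  rewrite kn.
  move=> [i /= ltin [[/record_at_record_time ik _] _]].
  by move: ltin; rewrite -ik -/(time k w) kj ltnNge nj.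
pose A := record_at X k j `&` dominant X j n.
have pA : past X n A.
  pose G := past_rectangles (fun i => X i : T -> R) n.
  apply: (@measurableI _ (g_sigma_algebraType G)); last exact: past_dominant.
  exact: (pastS jn (@past_record_at _ _ _ _ X k j)).
pose C := A `&` [set w | X j w < X n w].
have mC : measurable C.
  apply: measurableI; first exact: past_measurable pA.
  by apply: (@past_measurable _ _ _ _ X n.+1); apply: past_lt; lia.
have CE w : C w -> time k w = j /\ time k.+1 w = n.
  move=> [[kj dom] ov]; split; first exact: record_at_record_time.
  by apply: record_at_record_time; exists j.
rewrite -setIA (_ : _ `&` (_ `&` _) = unbounded_records X `&` C); last first.
  apply/seteqP; split => w [Uw]; last by move=> /CE.
  move=> [/= kj kn]; split => //.
  have : record_at X k.+1 (time k.+1 w) w by exact: unbounded_record_at.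
  rewrite kn.
  move=> [i /= ltin [[ik dom] ov]].
  have ij : i = j by rewrite -(record_at_record_time ik) -/(time k w) kj.
  by rewrite ij in ik dom ov.
rewrite -IU// -IU//.
transitivity (\int[P]_(w in C) (lomax_sf theta (X n w) `^ a)%:E)%E.
  apply: eq_integral => w /set_mem /CE[_ kn].
  exact: (congr1 (fun n => (lomax_sf theta (X n w) `^ a)%:E) kn).
rewrite (integral_past_record theta_gt0)//.
have gE : (\int[P]_(w in C) g w =
    (1 + a)^-1%:E * \int[P]_(w in C) f k.+1 w)%E.
  apply: ge0_integralZl => //; first exact: measurable_funTS.
  by rewrite lee_fin invr_ge0 addr_ge0.
have jE : (\int[P]_(w in C) (lomax_sf theta (X j w) `^ a)%:E =
    \int[P]_(w in C) f k.+1 w)%E.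
  apply: eq_integral => w /set_mem /CE[kj _].
  exact: (congr1 (fun n => (lomax_sf theta (X n w) `^ a)%:E) (esym kj)).
rewrite -/C jE; symmetry; exact: gE.
Qed.

Lemma ae_upper_record_gt0 m : {ae P, forall w, 0 < record m w}.
Proof.
exists (\bigcup_n ~` (X n @^-1` `]0, +oo[)); split.
- by apply: bigcupT_measurable => n; apply: measurableC; exact: measurable_funPTI.
- apply/negligibleP.
    by apply: bigcupT_measurable => n; apply: measurableC; exact: measurable_funPTI.
  apply: negligible_bigcup => n; apply/negligibleP.
    by apply: measurableC; exact: measurable_funPTI.
  have mX : measurable (X n @^-1` `]0, +oo[) by exact: measurable_funPTI.
  apply: (etrans (probability_setC P mX)).
  rewrite (_ : _ @^-1` _ = [set w | 0 < X n w]); last first.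
    by apply/seteqP; split => w /=; rewrite in_itv/= andbT.
  by rewrite (lomax_gt theta_gt0)// lomax_sf0 subee.
- move=> w /= H; exists (record_time (X ^~ w) m.-1) => //=.
  by rewrite in_itv/= andbT.
Qed.

(** The Laplace transform of - ln S(R), for the record R of rank m + 1, is that
    of the Gamma(m + 1, 1) law. *)
Lemma integral_upper_record (m : nat) (a : R) : 0 <= a ->
  (\int[P]_w (lomax_sf theta (record m.+1 w) `^ a)%:E =
   (((1 + a) ^+ m.+1)^-1)%:E)%E.
Proof.
move=> a0; elim: m => [|m IH].
  have E := integral_lomax_sf_tail theta_gt0 0 (X_lomax 0) a0.
  rewrite lomax_sf0 powR1 mulr1 in E; apply: etrans E.
  apply: ge0_ae_eq_integral => //.
  - apply/measurable_EFinP; apply: (measurableT_comp (measurable_powR _)).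
    apply: (measurableT_comp (measurable_lomax_sf theta)).
    exact: measurable_upper_record.
  - apply/measurable_EFinP; apply: measurable_funM.
      by apply: measurableT_comp => //; exact: measurable_indic.
    apply: (measurableT_comp (measurable_powR _)).
    exact: (measurableT_comp (measurable_lomax_sf theta)).
  - by move=> w _; rewrite lee_fin powR_ge0.
  - by move=> w _; rewrite lee_fin mulr_ge0// powR_ge0.
  apply: filterS (ae_upper_record_gt0 1) => w w0 _.
  by rewrite indicE mem_set ?mul1r//= in_itv/= andbT.
rewrite integral_upper_recordS//.
pose f w := (lomax_sf theta (record m.+1 w) `^ a)%:E.
transitivity (\int[P]_w ((1 + a)^-1%:E * f w))%E => //.
have fE : (\int[P]_w ((1 + a)^-1%:E * f w) = (1 + a)^-1%:E * \int[P]_w f w)%E.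
  apply: ge0_integralZl => //.
- apply/measurable_EFinP; apply: (measurableT_comp (measurable_powR _)).
  apply: (measurableT_comp (measurable_lomax_sf theta)).
  exact: measurable_upper_record.
- by move=> w _; rewrite lee_fin powR_ge0.
- by rewrite lee_fin invr_ge0 addr_ge0.
by apply: (etrans fE); rewrite /f IH -EFinM -invfM -exprS.
Qed.

End record_moments.

(** * Convergence of expectations by concentration *)

(** Squeeze: 1 + y <= expR y gives the lower bound at y = c / n and, since
    1 - c / (n + c) is the inverse of 1 + c / n, the upper bound at
    y = - c / (n + c). *)
Lemma cvg_expr_compound {R : realType} (c : R) : 0 <= c ->
  (fun n => ((1 + c / n.+1%:R) ^+ n.+1)^-1) @ \oo --> expR (- c).
Proof.
move=> c0.
have n0 n : (0 : R) < n.+1%:R by rewrite ltr0Sn.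
have b0 n : 0 < 1 + c / n.+1%:R by rewrite ltr_pwDl// divr_ge0.
have c_lim : (fun n => - (c / (1 + c / n.+1%:R))) @ \oo --> - c.
  apply: cvgN; rewrite -[X in _ --> X]divr1; apply: cvgM; first exact: cvg_cst.
  apply: cvgV; first exact: oner_neq0.
  rewrite -[X in _ --> X]addr0; apply: cvgD; first exact: cvg_cst.
  rewrite -[X in _ --> X](mulr0 c); apply: cvgM; first exact: cvg_cst.
  exact: cvg_harmonic.
apply: (@squeeze_cvgr _ _ _ _ (fun=> expR (- c))
  (fun n => expR (- (c / (1 + c / n.+1%:R))))).
- apply: nearW => n; apply/andP; split.
    rewrite expRN lef_pV2 ?posrE ?expR_gt0 ?exprn_gt0//.
    rewrite -[in leRHS](divfK (lt0r_neq0 (n0 n)) c) expRM_natr.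
    rewrite lerXn2r ?nnegrE ?expR_ge0 ?(ltW (b0 n))//.
    exact: expR_ge1Dx.
  have -> : - (c / (1 + c / n.+1%:R)) =
      - (c / n.+1%:R / (1 + c / n.+1%:R)) * n.+1%:R.
    by move: (n0 n); set N := _%:R => N0; field; apply/andP; split; lra.
  rewrite expRM_natr -exprVn lerXn2r ?nnegrE ?expR_ge0 ?invr_ge0 ?(ltW (b0 n))//.
  apply: le_trans (expR_ge1Dx _).
  rewrite le_eqVlt; apply/orP; left; apply/eqP.
  by move: (n0 n); set N := _%:R => N0; field; apply/andP; split; lra.
- exact: cvg_cst.
- apply: continuous_cvg => //; exact: continuous_expR.
Qed.

Lemma measurable_invr {R : realType} :
  measurable_fun [set: R] (GRing.inv : R -> R).
Proof.
have -> : (GRing.inv : R -> R) = (fun x => x * (x ^+ 2) `^ (-1)).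
  apply/funext => x; rewrite powR_inv1 ?sqr_ge0//.
  have [->|x0] := eqVneq x 0; first by rewrite invr0 mul0r.
  by field.
apply: measurable_funM => //.
by apply: (measurableT_comp (measurable_powR _)); exact: measurable_funX.
Qed.

Lemma integral_probability_cst {R : realType} d (T : measurableType d)
    (P : probability T R) (r : R) : (\int[P]_w r%:E = r%:E)%E.
Proof.
apply: (etrans (integral_cst P measurableT _)).
by rewrite [X in (_ * X)%E](probability_setT P) mule1.
Qed.

(** Expanding the square would subtract integrals; moving the cross term to the
    other side keeps all integrands nonnegative. *)
Lemma integral_sqr_dist {R : realType} d (T : measurableType d)
    (P : probability T R) (Z : T -> R) (z e1 e2 : R) :
    measurable_fun [set: T] Z -> (forall w, 0 <= Z w) -> 0 <= z ->
    (\int[P]_w (Z w)%:E = e1%:E)%E -> (\int[P]_w (Z w ^+ 2)%:E = e2%:E)%E ->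
  (\int[P]_w ((Z w - z) ^+ 2)%:E = (e2 + z ^+ 2 - 2 * z * e1)%:E)%E.
Proof.
move=> mZ Z0 z0 E1 E2.
have mEZ : measurable_fun [set: T] (EFin \o Z : T -> \bar R).
  exact/measurable_EFinP.
have mq : measurable_fun [set: T] (fun w => ((Z w - z) ^+ 2)%:E : \bar R).
  by apply/measurable_EFinP; apply: measurable_funX; exact: measurable_funB.
have mZ2 : measurable_fun [set: T] (fun w => (Z w ^+ 2)%:E : \bar R).
  by apply/measurable_EFinP; exact: measurable_funX.
have zz0 : 0 <= 2 * z by rewrite mulr_ge0.
have lin : (\int[P]_w ((2 * z)%:E * (Z w)%:E) = (2 * z * e1)%:E)%E.
  rewrite ge0_integralZl//; last by move=> w _; rewrite lee_fin.
  by rewrite E1.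
have cst : (\int[P]_w (z ^+ 2)%:E = (z ^+ 2)%:E)%E.
  exact: integral_probability_cst.
have : (\int[P]_w (((Z w - z) ^+ 2)%:E + (2 * z)%:E * (Z w)%:E) =
        \int[P]_w ((Z w ^+ 2)%:E + (z ^+ 2)%:E))%E.
  by apply: eq_integral => w _; rewrite -EFinM -!EFinD; congr EFin; ring.
rewrite ge0_integralD//; last 3 first.
- by move=> w _; rewrite lee_fin sqr_ge0.
- by move=> w _; rewrite -EFinM lee_fin mulr_ge0.
- exact: measurable_funeM.
rewrite ge0_integralD//; last 2 first.
- by move=> w _; rewrite lee_fin sqr_ge0.
- by move=> w _; rewrite lee_fin sqr_ge0.
rewrite lin cst E2 => /(congr1 (fun y => y - (2 * z * e1)%:E)%E).
by rewrite addeK// -EFinD -EFinB.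
Qed.

(** Continuity at z controls |G(Z) - G(z)| by e / 2 near z, boundedness controls
    it by a multiple of (Z - z)^2 elsewhere; hence the sum of both bounds holds
    everywhere, and it can be integrated. *)
Lemma cvg_integral_concentrated {R : realType} d (T : measurableType d)
    (P : probability T R) (Z : nat -> T -> R) (z M : R) (q : nat -> R)
    (G : R -> R) :
    (forall n, measurable_fun [set: T] (Z n)) ->
    measurable_fun [set: R] G -> {for z, continuous G} ->
    (forall n w, `|G (Z n w)| <= M) ->
    (forall n, \int[P]_w ((Z n w - z) ^+ 2)%:E = (q n)%:E)%E ->
    q @ \oo --> 0 ->
  (fun n => \int[P]_w (G (Z n w))%:E)%E @ \oo --> (G z)%:E.
Proof.
move=> mZ mG cG GM qE q0.
have mGZ n : measurable_fun [set: T] (fun w => (G (Z n w))%:E : \bar R).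
  by apply/measurable_EFinP; exact: (measurableT_comp mG (mZ n)).
have icst r : P.-integrable [set: T] (EFin \o cst r).
  exact: finite_measure_integrable_cst.
have iGZ n : P.-integrable [set: T] (EFin \o (fun w => G (Z n w))).
  apply: (le_integrable _ (mGZ n) _ (icst M)) => // w _.
  by rewrite /= lee_fin (le_trans (GM n w))// ler_norm.
have fGZ n : (\int[P]_w (G (Z n w))%:E)%E \is a fin_num.
  exact: (integrable_fin_num _ (iGZ n)).
apply: cvg_EFin; first exact: nearW.
apply/cvgrPdist_le => e e0.
have [dl dl0 Gdl] : exists2 dl, 0 < dl &
    forall y, `|z - y| < dl -> `|G z - G y| <= e / 2.
  have e20 : 0 < e / 2 by rewrite divr_gt0.
  have /cvgrPdist_le/(_ _ e20)/nbhs_ballP[dl /= dl0 H] := cG.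
  by exists dl => // y zy; exact: H.
pose K := (M + `|G z|) / dl ^+ 2.
have bound n w : `|G (Z n w) - G z| <= e / 2 + K * (Z n w - z) ^+ 2.
  have M0 : 0 <= M + `|G z| by rewrite addr_ge0// (le_trans _ (GM n w)).
  have [near_z|far] := ltP `|z - Z n w| dl.
    rewrite distrC (le_trans (Gdl _ near_z))// lerDl mulr_ge0 ?sqr_ge0//.
    by rewrite divr_ge0// sqr_ge0.
  apply: (le_trans (ler_normB _ _)); apply: (@le_trans _ _ (M + `|G z|)).
    by rewrite lerD2r.
  apply: ler_wpDl; first by rewrite divr_ge0// ltW.
  rewrite /K mulrAC ler_pdivlMr ?exprn_gt0//.
  rewrite ler_wpM2l// -(real_normK (num_real (Z n w - z))) distrC.
  by rewrite lerXn2r ?nnegrE// ltW.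
have mq n : measurable_fun [set: T] (fun w => ((Z n w - z) ^+ 2)%:E : \bar R).
  by apply/measurable_EFinP; apply: measurable_funX; exact: measurable_funB.
have dist n : `|G z - fine (\int[P]_w (G (Z n w))%:E)| <= e / 2 + K * q n.
  rewrite distrC -lee_fin -abse_EFin EFinB fineK//.
  rewrite -[X in (_ - X)%E](integral_probability_cst P).
  rewrite -integralB_EFin//; last first.
    exact: icst.
  apply: le_trans (le_abse_integral _ _ _) _ => //.
    by apply: emeasurable_funB.
  have K0 : 0 <= K.
    by rewrite divr_ge0 ?sqr_ge0// addr_ge0// (le_trans _ (GM n point)).
  apply: (@le_trans _ _
    (\int[P]_w ((e / 2)%:E + K%:E * ((Z n w - z) ^+ 2)%:E))%E).
    apply: ge0_le_integral => //.
    - by apply: measurableT_comp => //; exact: emeasurable_funB.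
    - by apply: emeasurable_funD => //; exact: measurable_funeM.
    - by move=> w _; rewrite -EFinB /= -EFinM -EFinD lee_fin.
  rewrite ge0_integralD//; last 3 first.
  - by move=> w _; rewrite lee_fin divr_ge0// ltW.
  - by move=> w _; rewrite -EFinM lee_fin mulr_ge0 ?sqr_ge0.
  - exact: measurable_funeM.
  rewrite integral_probability_cst ge0_integralZl//; last first.
    by move=> w _; rewrite lee_fin sqr_ge0.
  by rewrite qE -EFinM -EFinD.
have Kq : K * q n @[n --> \oo] --> 0.
  by rewrite -[X in _ --> X](mulr0 K); apply: cvgM => //; exact: cvg_cst.
near=> n.
apply: (le_trans (dist n)); rewrite -lerBrDl.
have : K * q n <= e / 2 by near: n; apply: (cvgr_le 0) => //; exact: divr_gt0.
by move=> /le_trans; apply; lra.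
Unshelve. all: by end_near. Qed.

Lemma integral_expR_exponent {R : realType} (s : R) : 0 < s ->
  (\int[lebesgue_measure]_(a in `[0%R, +oo[) (expR (- s * a))%:E = (s^-1)%:E)%E.
Proof.
move=> s0.
have := integral_exponential_pdf s0.
have -> : (\int[lebesgue_measure]_x (exponential_pdf s x)%:E =
    \int[lebesgue_measure]_(x in `[0%R, +oo[) (s%:E * (expR (- s * x))%:E))%E.
  rewrite [RHS]integral_mkcond; apply: eq_integral => x _.
  rewrite patchE; case: ifPn => [/set_mem/=|/negP nx].
    by rewrite in_itv/= andbT => x0; rewrite exponential_pdfE.
  rewrite lt0_exponential_pdf// ltNge; apply/negP => x0; apply: nx.
  by apply/mem_set; rewrite /= in_itv/= andbT.
rewrite ge0_integralZl//; last 2 first.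
- apply/measurable_EFinP; apply: measurable_funTS.
  apply: (measurableT_comp (@measurable_expR R)).
  exact: mulrl_measurable.
- by rewrite lee_fin ltW.
move=> /(congr1 (fun y => (s^-1)%:E * y)%E).
by rewrite muleA -EFinM mulVf ?gt_eqF// mul1e mule1.
Qed.

(** * Plug-in estimators *)
Section plug_in.
Context {R : realType} d (T : measurableType d) (P : probability T R).
Variables (theta : R) (X : nat -> {RV P >-> R}).
Hypothesis theta_gt0 : 0 < theta.
Hypothesis X_indep : mutually_independent X.
Hypothesis X_lomax : forall n, lomax_distributed theta (X n).

Let record m w := upper_record (X ^~ w) m.

Lemma measurable_mle m :
  measurable_fun [set: T] (fun w => m%:R / ln (1 + record m w)).
Proof.
apply: measurable_funM => //; apply: (measurableT_comp measurable_invr).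
apply: (measurableT_comp (@measurable_ln R)); apply: measurable_funD => //.
exact: measurable_upper_record.
Qed.

(** With Z = S(R)^(1/m), the estimate m / ln (1 + R) equals
    1 / (theta * - ln Z), and the moment formula at a = 1/m and a = 2/m shows that
    Z concentrates at expR (- 1), where this expression takes the value
    1 / theta. *)
Lemma cvg_integral_plug_in (g : R -> R) (M : R) :
    measurable_fun [set: R] g -> {for theta^-1, continuous g} ->
    (forall u, 0 <= u -> `|g u| <= M) ->
  (fun m => \int[P]_w (g (m%:R / ln (1 + record m w)))%:E)%E @ \oo
    --> (g theta^-1)%:E.
Proof.
move=> mg cg gM; rewrite -cvg_shiftS /=.
pose Z m w := lomax_sf theta (record m.+1 w) `^ m.+1%:R^-1.
pose G z := g ((theta * - ln z)^-1).
have Z01 m w : 0 < Z m w <= 1.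
  have sf0 := lomax_sf_gt0 theta (record m.+1 w).
  rewrite powR_gt0//= -(powRr0 (lomax_sf theta (record m.+1 w))).
  by rewrite ger_powR ?invr_ge0// sf0 lomax_sf_le1.
have mZ m : measurable_fun [set: T] (Z m).
  apply: (measurableT_comp (measurable_powR _)).
  apply: (measurableT_comp (measurable_lomax_sf theta)).
  exact: measurable_upper_record.
have mG : measurable_fun [set: R] G.
  apply: (measurableT_comp mg); apply: (measurableT_comp measurable_invr).
  apply: measurable_funM => //; apply: measurable_funN.
  exact: measurable_ln.
have GE : G (expR (- 1)) = g theta^-1.
  by rewrite /G expRK opprK mulr1.
have cG : {for expR (- 1), continuous G}.
  have cinv : {for expR (- 1), continuous (fun z : R => (theta * - ln z)^-1)}.
    apply: cvgV; first by rewrite expRK opprK mulr1 gt_eqF.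
    apply: cvgM; first exact: cvg_cst.
    by apply: cvgN; apply: continuous_ln; exact: expR_gt0.
  apply: (continuous_comp cinv).
  by rewrite expRK opprK mulr1.
have GM m w : `|G (Z m w)| <= M.
  apply: gM; rewrite invr_ge0; apply: mulr_ge0; first exact: ltW.
  by rewrite oppr_ge0; apply: ln_le0; have /andP[] := Z01 m w.
have Z1 m : (\int[P]_w (Z m w)%:E = (((1 + 1 / m.+1%:R) ^+ m.+1)^-1)%:E)%E.
  by rewrite div1r integral_upper_record// invr_ge0.
have Z2 m : (\int[P]_w (Z m w ^+ 2)%:E = (((1 + 2 / m.+1%:R) ^+ m.+1)^-1)%:E)%E.
  under eq_integral do rewrite -powR_mulrn ?powR_ge0// -powRrM mulrC.
  by rewrite integral_upper_record// divr_ge0.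
have -> : (fun n => \int[P]_w (g (n.+1%:R / ln (1 + record n.+1 w)))%:E)%E =
    (fun n => \int[P]_w (G (Z n w))%:E)%E.
  apply/funext => m; apply: ae_eq_integral => //.
  - apply/measurable_EFinP; apply: (measurableT_comp mg).
    exact: measurable_mle.
  - by apply/measurable_EFinP; exact: (measurableT_comp mG (mZ m)).
  apply: filterS (ae_upper_record_gt0 theta_gt0 X_lomax m.+1) => w w0 _.
  congr (g _)%:E; rewrite /Z /lomax_sf max_r; last exact: ltW.
  have : 0 < ln (1 + record m.+1 w) by rewrite ln_gt0// ltrDl.
  rewrite !ln_powR; move: (ln _) => L L0.
  have N0 : 0 < m.+1%:R :> R by rewrite ltr0Sn.
  by field; rewrite !gt_eqF.
rewrite -GE; apply: (cvg_integral_concentrated mZ mG cG GM).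
  move=> m; apply: integral_sqr_dist (Z1 m) (Z2 m) => //.
    by move=> w; have /andP[/ltW] := Z01 m w.
have lim1 := cvg_expr_compound (@ler01 R).
have lim2 := cvg_expr_compound (@ler0n R 2).
have -> : (0 : R) = expR (- 2) + expR (- 1) ^+ 2 - 2 * expR (- 1) * expR (- 1).
  rewrite (_ : - 2 = - 1 + - 1 :> R); last by ring.
  by rewrite expRD; ring.
apply: cvgB; first by apply: cvgD => //; exact: cvg_cst.
by apply: cvgM => //; exact: cvg_cst.
Qed.

(** Tonelli: 1 / (- ln V) is the integral of V^a over a >= 0, and the expectation
    of V^a is (1 + a)^(- (m + 2)).  The rank is m + 2 because the expectation is
    infinite at rank 1. *)
Lemma integral_inv_mle (m : nat) :
  (\int[P]_w (m.+2%:R / ln (1 + record m.+2 w))%:E =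
   (m.+2%:R / theta * m.+1%:R^-1)%:E)%E.
Proof.
pose c := m.+2%:R / theta.
have c0 : 0 <= c by rewrite divr_ge0// ltW.
pose V w := lomax_sf theta (record m.+2 w).
have mV : measurable_fun [set: T] V.
  apply: (measurableT_comp (measurable_lomax_sf theta)).
  exact: measurable_upper_record.
pose F (z : T * measurableTypeR R) : \bar R :=
  (\1_(`[0, +oo[%classic : set R) z.2 * expR (z.2 * ln (V z.1)))%:E.
have mF : measurable_fun [set: T * measurableTypeR R] F.
  apply/measurable_EFinP; apply: measurable_funM.
    apply: measurableT_comp => //; exact: measurable_indic.
  apply: (measurableT_comp (@measurable_expR R)); apply: measurable_funM => //.
  apply: (measurableT_comp (@measurable_ln R)).
  exact: (measurableT_comp mV).
have F0 z : (0 <= F z)%E by rewrite lee_fin mulr_ge0// expR_ge0.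
transitivity (\int[P]_w (c%:E * \int[lebesgue_measure]_a F (w, a)))%E.
  apply: ae_eq_integral => //.
  - by apply/measurable_EFinP; exact: measurable_mle.
  - apply: measurable_funeM; exact: measurable_fun_fubini_tonelli_F.
  apply: filterS (ae_upper_record_gt0 theta_gt0 X_lomax m.+2) => w w0 _.
  have L0 : 0 < ln (1 + record m.+2 w) by rewrite ln_gt0// ltrDl.
  have lnV : ln (V w) = - (ln (1 + record m.+2 w) / theta).
    by rewrite /V /lomax_sf max_r ?ltW// ln_powR mulNr mulrC.
  transitivity (c%:E * \int[lebesgue_measure]_(a in `[0%R, +oo[)
      (expR (- (ln (1 + record m.+2 w) / theta) * a))%:E)%E.
    rewrite integral_expR_exponent ?divr_gt0// -EFinM.
    by congr EFin; rewrite /c; field; rewrite !gt_eqF.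
  congr (_ * _)%E; rewrite integral_mkcond; apply: eq_integral => a _.
  rewrite patchE /F/= indicE; case: ifPn => a0; last by rewrite mul0r.
  by rewrite mul1r lnV mulrC.
rewrite ge0_integralZl//; last 2 first.
- exact: measurable_fun_fubini_tonelli_F.
- by move=> w _; exact: integral_ge0.
rewrite (fubini_tonelli F)//.
transitivity (c%:E * \int[lebesgue_measure]_(a in `[0%R, +oo[)
    ((1 + a) `^ (- (m.+1%:R + 1)))%:E)%E.
  congr (_ * _)%E; rewrite [RHS]integral_mkcond; apply: eq_integral => a _.
  rewrite patchE /F/=; case: ifPn => [a0|/negbTE a0]; last first.
    by apply: integral0_eq => w _; rewrite indicE a0 mul0r.
  have {}a0' : 0 <= a by move/set_mem: a0; rewrite /= in_itv/= andbT.
  transitivity (\int[P]_w (V w `^ a)%:E)%E.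
    apply: eq_integral => w _; rewrite indicE a0 mul1r /powR gt_eqF//.
    exact: lomax_sf_gt0.
  rewrite /V integral_upper_record//.
  by rewrite natr1 powR_invn// addr_ge0.
by rewrite integral_powR_tail// addr0 powR1 mulr1.
Qed.

Lemma cvg_integral_mle :
  (fun m => \int[P]_w (m%:R / ln (1 + record m w))%:E)%E @ \oo
    --> (theta^-1)%:E.
Proof.
rewrite -(cvg_shiftn 2) /=.
have -> : (fun m => \int[P]_w ((m + 2)%:R / ln (1 + record (m + 2) w))%:E)%E =
    (fun m => (theta^-1 + theta^-1 * m.+1%:R^-1)%:E).
  apply/funext => m; rewrite addn2 integral_inv_mle; congr EFin.
  have : 0 < m.+1%:R :> R by rewrite ltr0Sn.
  rewrite -[m.+2%:R]natr1; move: (m.+1%:R) => N N0; field.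
  by rewrite !gt_eqF.
apply: cvg_EFin; first exact: nearW.
rewrite -[X in _ --> X]addr0; apply: cvgD; first exact: cvg_cst.
rewrite -[X in _ --> X](mulr0 theta^-1); apply: cvgM; first exact: cvg_cst.
exact: cvg_harmonic.
Qed.

End plug_in.

Theorem theorem3 (R : realType) (d : measure_display) (T : measurableType d)
    (P : probability T R) (theta : R) (X : nat -> {RV P >-> R})
    (theta_gt0 : 0 < theta)
    (X_indep : mutually_independent X)
    (X_lomax : forall n : nat, lomax_distributed theta (X n))
    (x : R) (x_ge0 : 0 <= x) :
  ((fun m : nat =>
      'E_P[fun w : T => records_pdf_estimator m (upper_record (X ^~ w) m) x]%E)
     @ \oo --> (theta^-1 * (1 + x) `^ (- (theta^-1 + 1)))%:E) /\
  ((fun m : nat =>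
      'E_P[fun w : T => records_cdf_estimator m (upper_record (X ^~ w) m) x]%E)
     @ \oo --> (1 - (1 + x) `^ (- theta^-1))%:E).
Proof.
have x1 : 0 < 1 + x by rewrite ltr_pwDl.
have powRE (u : R) : (1 + x) `^ u = expR (u * ln (1 + x)).
  by rewrite /powR gt_eqF.
have cexp (h : R -> R) (u : R) : {for u, continuous h} ->
    {for u, continuous (fun u => (1 + x) `^ h u)}.
  move=> ch.
  have E : (fun v => (1 + x) `^ h v) = (fun v => expR (h v * ln (1 + x))).
    by apply/funext => v; rewrite powRE.
  apply: (eq_ind_r (fun f : R -> R => {for u, continuous f}) _ E).
  apply: (@continuous_comp _ _ _ (fun u => h u * ln (1 + x)) expR).
    by apply: cvgM => //; exact: cvg_cst.
  exact: continuous_expR.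
pose gc u := 1 - (1 + x) `^ (- u).
have cdfE m :
    ('E_P[fun w => records_cdf_estimator m (upper_record (X ^~ w) m) x] =
     \int[P]_w (gc (m%:R / ln (1 + upper_record (X ^~ w) m)))%:E)%E.
  by rewrite unlock.
pose gp u := u * (1 + x) `^ (- (u + 1)).
have pdfE m :
    ('E_P[fun w => records_pdf_estimator m (upper_record (X ^~ w) m) x] =
     \int[P]_w (gp (m%:R / ln (1 + upper_record (X ^~ w) m)))%:E)%E.
  by rewrite unlock.
split; last first.
  under eq_fun do rewrite cdfE.
  apply: (@cvg_integral_plug_in _ _ _ _ _ _ theta_gt0 X_indep X_lomax gc 1).
  - apply: measurable_funB => //.
    apply: (measurableT_comp (measurable_powRr _)).
    exact: oppr_measurable.
  - apply: cvgB; first exact: cvg_cst.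
    by apply: cexp; exact: continuousN.
  - move=> u u0; rewrite ger0_norm ?lerBlDr ?lerDl ?powR_ge0// subr_ge0.
    apply: (@le_trans _ _ ((1 + x) `^ 0)); last by rewrite powRr0.
    by rewrite ler_powR ?lerDl// oppr_le0.
under eq_fun do rewrite pdfE.
have [x0|x0] := eqVneq x 0; last first.
  have L0 : 0 < ln (1 + x) by rewrite ln_gt0// ltrDl lt_neqAle eq_sym x0.
  apply: (@cvg_integral_plug_in _ _ _ _ _ _ theta_gt0 X_indep X_lomax gp
    (ln (1 + x))^-1).
  - apply: measurable_funM => //.
    apply: (measurableT_comp (measurable_powRr _)).
    apply: (measurableT_comp (@oppr_measurable R setT)).
    exact: measurable_funD.
  - apply: cvgM; first exact: cvg_id.
    apply: (cexp (fun u => - (u + 1))); apply: continuousN.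
    by apply: cvgD; [exact: cvg_id|exact: cvg_cst].
  - move=> u u0; rewrite ger0_norm ?mulr_ge0 ?powR_ge0//.
    rewrite /gp powRE -[leRHS]mul1r ler_pdivlMr//.
    move: (ln (1 + x)) L0 => L L0.
    have uL : u * L <= expR (u * L) by have := expR_ge1Dx (u * L); lra.
    have eL : expR (- (u + 1) * L) <= expR (- (u * L)) by rewrite ler_expR; nra.
    apply: (@le_trans _ _ (expR (u * L) * expR (- (u * L)))).
      by rewrite mulrAC ler_pM ?expR_ge0// mulr_ge0// ltW.
    by rewrite -expRD subrr expR0.
have gpE u : gp u = u by rewrite /gp x0 addr0 powR1 mulr1.
rewrite x0 addr0 !powR1 !mulr1.
under eq_fun do under eq_integral do rewrite gpE.
exact: cvg_integral_mle theta_gt0 X_indep X_lomax.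
Qed.
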